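(* Let $\mathcal{A} = \mathcal{A}_1 \times \cdots \times \mathcal{A}_d$ be a product of finite nonempty sets, and let $p_\theta(\mathbf{a}) = \prod_{i=1}^d p_\theta(a_i \mid \mathbf{a}_{i-1})$ be an autoregressive distribution on $\mathcal{A}$. Let $\mathbf{A} = (A_1,\dots,A_d)$ be a random variable with distribution $p_\theta(\cdot)$. Then the smoothed entropy estimator $\widetilde{H}_\theta(\mathbf{A})$ is an unbiased estimator of the exact entropy $H_\theta$, i.e. $$\mathrm{E}_{\mathbf{A}\sim p_\theta}\big[\widetilde{H}_\theta(\mathbf{A})\big] = H_\theta .$$
   Context: For $\mathbf{a} = (a_1,\dots,a_d) \in \mathcal{A}$ write $\mathbf{a}_i = (a_1,\dots,a_i)$ for its prefix of length $i$ ($\mathbf{a}_0$ is the empty prefix); similarly $\mathbf{A}_i = (A_1,\dots,A_i)$. Autoregressive model: for each $i = 1,\dots,d$ and each prefix $\mathbf{a}_{i-1} \in \mathcal{A}_1\times\cdots\times\mathcal{A}_{i-1}$ one is given a probability distribution $p_\theta(\cdot \mid \mathbf{a}_{i-1})$ on $\mathcal{A}_i$ depending on a parameter $\theta$, and the joint distribution on $\mathcal{A}$ is defined by $p_\theta(\mathbf{a}) = \prod_{i=1}^d p_\theta(a_i\mid \mathbf{a}_{i-1})$. Exact entropy: $H_\theta = -\sum_{\mathbf{a}\in\mathcal{A}} p_\theta(\mathbf{a}) \log p_\theta(\mathbf{a})$. Smoothed entropy estimator: for $\mathbf{a}\in\mathcal{A}$, $$\widetilde{H}_\theta(\mathbf{a})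 = \sum_{i=1}^d H_\theta^{(i)}(\mathbf{a}_{i-1}), \qquad H_\theta^{(i)}(\mathbf{a}_{i-1}) = -\sum_{a\in\mathcal{A}_i} p_\theta(a\mid \mathbf{a}_{i-1}) \log p_\theta(a\mid \mathbf{a}_{i-1}).$$ Convention: $0\log 0 = 0$. *)

(* Defs.v *)
From HB Require Import structures.
From mathcomp Require Import all_boot all_order all_algebra.
From mathcomp Require Import all_classical all_reals all_analysis.

Set Implicit Arguments.
Unset Strict Implicit.
Unset Printing Implicit Defensive.

Import Order.TTheory GRing.Theory Num.Theory.
Local Open Scope classical_set_scope.
Local Open Scope ring_scope.

(* A nonempty finite set. The distinguished point is needed only because a
   measurable type has to be pointed; no formula below uses it. *)
#[short(type="pointedFinType")]
HB.structure Definition PointedFinite := {T of Finite T & Pointed T}.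

(* Coordinates are 0-based: [i : 'I_d] stands for the index [i + 1] of
   a_1, ..., a_d, so that the prefix of length [i] precedes coordinate [i]. *)
Definition outcome (d : nat) (A : 'I_d -> pointedFinType) : Type :=
  {dffun forall i : 'I_d, A i}.

(* A finite product of finite sets carries the discrete sigma-algebra. *)
Section outcome_instances.
Variables (d : nat) (A : 'I_d -> pointedFinType).

HB.instance Definition _ := Finite.on (outcome A).
HB.instance Definition _ :=
  isPointed.Build (outcome A) [ffun i : 'I_d => (point : A i)].
HB.instance Definition _ := @isMeasurable.Build default_measure_display
  (outcome A) (@discrete_measurable (outcome A)) (@discrete_measurable0 _)
  (@discrete_measurableC _) (@discrete_measurableU _).

End outcome_instances.

Definition outcome_prefix (d : nat) (A : 'I_d -> pointedFinType) (k : nat)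
    (le_kd : (k <= d)%N) : Type :=
  {dffun forall j : 'I_k, A (widen_ord le_kd j)}.

Definition take_prefix (d : nat) (A : 'I_d -> pointedFinType) (k : nat)
    (le_kd : (k <= d)%N) (a : outcome A) : outcome_prefix A le_kd :=
  [ffun j : 'I_k => a (widen_ord le_kd j)].

(* [q i u b] is the probability of the value [b] in coordinate [i] given that
   the coordinates [0, ..., i - 1] are [u]. *)
Definition conditionals (R : realType) (d : nat) (A : 'I_d -> pointedFinType)
    : Type :=
  forall i : 'I_d, outcome_prefix A (ltnW (ltn_ord i)) -> A i -> R.

Definition is_pmf (R : realType) (S : finType) (q : S -> R) : Prop :=
  (forall s : S, 0 <= q s) /\ \sum_(s : S) q s = 1.

Definition joint (R : realType) (d : nat) (A : 'I_d -> pointedFinType)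
    (q : conditionals R A) (a : outcome A) : R :=
  \prod_(i < d) q i (take_prefix (ltnW (ltn_ord i)) a) (a i).

(* Natural logarithm. Since [ln 0 = 0], null terms contribute 0. *)
Definition entropy (R : realType) (S : finType) (q : S -> R) : R :=
  - \sum_(s : S) q s * ln (q s).

Definition smoothed_entropy (R : realType) (d : nat)
    (A : 'I_d -> pointedFinType) (q : conditionals R A) (a : outcome A) : R :=
  \sum_(i < d) entropy (q i (take_prefix (ltnW (ltn_ord i)) a)).

(* Main.v *)
(* Every factor is a probability, so for a null outcome a both sides get 0
   from a, and otherwise ln (joint a) is the sum of the ln q_i(a_i | a_{i-1}).
   It remains to replace, under the joint law and for each i, the value
   - ln q_i(a_i | a_{i-1}) by its conditional expectation given a_{i-1}.
   To avoid sums over prefixes, all sums range over full outcomes: a function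
   of the first k coordinates is summed with a uniform overcount, and averaging
   over coordinate k becomes resampling that coordinate. *)
Require Import Defs.
From mathcomp Require Import all_boot all_order all_algebra.
From mathcomp Require Import all_classical all_reals all_analysis.

Set Implicit Arguments.
Unset Strict Implicit.
Unset Printing Implicit Defensive.

Import Order.TTheory GRing.Theory Num.Theory.
Local Open Scope classical_set_scope.
Local Open Scope ring_scope.

Section outcome_sums.
Variables (R : realType) (d : nat) (A : 'I_d -> pointedFinType).

Definition update (a : outcome A) (i : 'I_d) (b : A i) : outcome A :=
  [ffun j : 'I_d => dfwith a i b j].

Lemma update_same (a : outcome A) (i : 'I_d) (b : A i) : update a b i = b.
Proof. by rewrite ffunE dfwithin. Qed.

Lemma update_other (a : outcome A) (i j : 'I_d) (b : A i) :
  i != j -> update a b j = a j.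
Proof. by move=> ij; rewrite ffunE dfwithout. Qed.

(** The map sending [(a, b)] to [(update a b, a i)] is an involution on pairs; reindexing by it
    turns the summand into [F a], which no longer involves [b]. *)
Lemma sum_update (i : 'I_d) (F : outcome A -> R) :
  \sum_(a : outcome A) \sum_(b : A i) F (update a b)
  = #|A i|%:R * \sum_(a : outcome A) F a.
Proof.
pose swap (x : outcome A * A i) := (update x.1 x.2, x.1 i).
have swapK : involutive swap.
  case=> a b; rewrite /swap /= update_same; congr pair.
  apply/ffunP => j; rewrite ffunE; have [<-|ij] := eqVneq i j.
    by rewrite dfwithin.
  by rewrite dfwithout// update_other.
rewrite pair_bigA /= (reindex_inj (inv_inj swapK)) /=.
under eq_bigr => x _ do rewrite -[update _ _]/((swap (swap x)).1) swapK.
rewrite -(pair_bigA _ (fun a _ => F a)) /= mulr_sumr.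
by apply: eq_bigr => a _; rewrite sumr_const mulr_natl.
Qed.

Definition prefix_determined (k : nat) (V : Type) (F : outcome A -> V) : Prop :=
  forall a a' : outcome A,
    (forall j : 'I_d, (j < k)%N -> a j = a' j) -> F a = F a'.

Lemma prefix_determined_update (i : 'I_d) (V : Type) (F : outcome A -> V)
    (a : outcome A) (b : A i) :
  prefix_determined i F -> F (update a b) = F a.
Proof.
move=> Fi; apply: Fi => j ji; apply: update_other.
by apply: contraTneq ji => ->; rewrite ltnn.
Qed.

Lemma take_prefix_determined (k : nat) (le_kd : (k <= d)%N) :
  prefix_determined k (@take_prefix d A k le_kd).
Proof.
by move=> a a' aa'; apply/ffunP => j; rewrite !ffunE; apply: aa'; exact: (ltn_ord j).
Qed.

(** Resampling coordinate [i] changes neither [F] nor the prefix passed to [g], so [sum_update] only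
    affects the last argument of [g]. *)
Lemma coordinate_sum (i : 'I_d) (F : outcome A -> R)
    (g : outcome_prefix A (ltnW (ltn_ord i)) -> A i -> R) :
  prefix_determined i F ->
  #|A i|%:R * \sum_(a : outcome A)
      F a * g (take_prefix (ltnW (ltn_ord i)) a) (a i)
  = \sum_(a : outcome A)
      F a * \sum_(b : A i) g (take_prefix (ltnW (ltn_ord i)) a) b.
Proof.
move=> Fi; rewrite -sum_update; apply: eq_bigr => a _.
rewrite mulr_sumr; apply: eq_bigr => b _.
rewrite update_same !prefix_determined_update//.
exact: take_prefix_determined.
Qed.

Lemma card_coordinate_neq0 (i : 'I_d) : #|A i|%:R != 0 :> R.
Proof. by rewrite pnatr_eq0 -lt0n; apply/card_gt0P; exists point. Qed.

Variable q : conditionals R A.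
Hypothesis q_pmf : forall (i : 'I_d) (u : outcome_prefix A (ltnW (ltn_ord i))),
  is_pmf (q u).

Local Notation pre a i := (take_prefix (ltnW (ltn_ord i)) a).

Definition partial_joint (k : nat) (a : outcome A) : R :=
  \prod_(j < d | (j < k)%N) q (pre a j) (a j).

Lemma partial_joint_determined (k : nat) : prefix_determined k (partial_joint k).
Proof.
move=> a a' aa'; apply: eq_bigr => j jk.
rewrite (aa' j jk) (@take_prefix_determined _ _ a a')// => l lj.
by apply: aa'; exact: ltn_trans jk.
Qed.

(* [F] ignores the coordinates from [k] on, so that the right-hand side counts
   each of its prefixes once per completion; the cardinals compensate. *)
Lemma sum_tail (k : nat) (F : outcome A -> R) : (k <= d)%N ->
  prefix_determined k F ->
  (\prod_(j < d | (k <= j)%N) #|A j|%:R) *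
    \sum_(a : outcome A) F a * \prod_(j < d | (k <= j)%N) q (pre a j) (a j)
  = \sum_(a : outcome A) F a.
Proof.
(* Induction on the number [n] of coordinates from [k] on, peeling off coordinate [k]. *)
move=> kd; have [n] : exists n, (n + k)%N = d by exists (d - k)%N; rewrite subnK.
elim: n k F kd => [|n IH] k F kd nk Fk.
  have no_tail (j : 'I_d) : (k <= j)%N = false.
    by apply/negbTE; rewrite -ltnNge (leq_trans (ltn_ord j))// -nk.
  rewrite big_pred0// mul1r.
  by apply: eq_bigr => a _; rewrite big_pred0 ?mulr1.
have lt_kd : (k < d)%N by rewrite -nk addSn ltnS leq_addl.
pose i : 'I_d := Ordinal lt_kd.
have headE (G : 'I_d -> R) : \prod_(j < d | (k <= j)%N) G j
    = G i * \prod_(j < d | (k.+1 <= j)%N) G j.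
  rewrite (bigD1 i) ?leqnn//=; congr (_ * _); apply: eq_bigl => j.
  by rewrite ltn_neqAle andbC eq_sym.
(* Absorbing the factor of coordinate [k] into [F] raises the cut to [k + 1], so the induction
   hypothesis removes all later factors. *)
have Fqi : prefix_determined k.+1 (fun a => F a * q (pre a i) (a i)).
  move=> a a' aa'; congr (_ * _).
    by apply: Fk => j jk; apply: aa'; exact: ltnW.
  rewrite (aa' i)// (@take_prefix_determined _ _ a a')// => j ji.
  by apply: aa'; exact: ltnW.
rewrite headE -mulrA.
under [X in _ * (_ * X) = _]eq_bigr => a _ do rewrite headE mulrA.
rewrite (IH k.+1 _ lt_kd _ Fqi) ?addnS//.
(* The remaining cardinal pays for resampling coordinate [k], whose conditional probabilities sum to
   1. *)
rewrite (coordinate_sum (@q i) Fk)//.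
by apply: eq_bigr => a _; rewrite (q_pmf _).2 mulr1.
Qed.

(** By [sum_tail] both sides become plain sums after multiplication by the same nonzero product of
    cardinals, which then cancels. *)
Lemma sum_tail_eq (k : nat) (F G : outcome A -> R) : (k <= d)%N ->
  prefix_determined k F -> prefix_determined k G ->
  \sum_(a : outcome A) F a = \sum_(a : outcome A) G a ->
  \sum_(a : outcome A) F a * \prod_(j < d | (k <= j)%N) q (pre a j) (a j)
  = \sum_(a : outcome A) G a * \prod_(j < d | (k <= j)%N) q (pre a j) (a j).
Proof.
have card_neq0 : \prod_(j < d | (k <= j)%N) #|A j|%:R != 0 :> R.
  by apply/prodf_neq0 => j _; exact: card_coordinate_neq0.
by move=> kd Fk Gk FG; apply: (mulfI card_neq0); rewrite !sum_tail.
Qed.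

Lemma joint_split (k : nat) (a : outcome A) : joint q a =
  partial_joint k a * \prod_(j < d | (k <= j)%N) q (pre a j) (a j).
Proof.
rewrite /joint (bigID (fun j : 'I_d => (j < k)%N)) /=; congr (_ * _).
by under eq_bigl => j do rewrite -leqNgt.
Qed.

Lemma partial_jointS (i : 'I_d) (a : outcome A) :
  partial_joint i.+1 a = partial_joint i a * q (pre a i) (a i).
Proof.
rewrite /partial_joint (bigD1 i) ?leqnn//= mulrC; congr (_ * _).
by apply: eq_bigl => j; rewrite ltnS [RHS]ltn_neqAle andbC.
Qed.

Lemma conditional_expectation (i : 'I_d)
    (g : outcome_prefix A (ltnW (ltn_ord i)) -> A i -> R) :
  \sum_(a : outcome A) joint q a * \sum_(b : A i) q (pre a i) b * g (pre a i) b
  = \sum_(a : outcome A) joint q a * g (pre a i) (a i).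
Proof.
pose h u := \sum_(b : A i) q u b * g u b.
have pi_det (j : 'I_d) (V : Type) (f : outcome_prefix A (ltnW (ltn_ord j)) -> V) :
    prefix_determined j.+1 (fun a => f (pre a j)).
  move=> a a' aa'; rewrite (@take_prefix_determined _ _ a a')// => l lj.
  by apply: aa'; exact: ltnW.
(* The cut is at [i + 1] rather than [i] because [g] reads coordinate [i] itself. *)
transitivity (\sum_(a : outcome A) (partial_joint i.+1 a * h (pre a i)) *
    \prod_(j < d | (i.+1 <= j)%N) q (pre a j) (a j)).
  by apply: eq_bigr => a _; rewrite (joint_split i.+1) mulrAC.
transitivity (\sum_(a : outcome A) (partial_joint i.+1 a * g (pre a i) (a i)) *
    \prod_(j < d | (i.+1 <= j)%N) q (pre a j) (a j)); last first.
  by apply: eq_bigr => a _; rewrite (joint_split i.+1) mulrAC.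
apply: sum_tail_eq => //.
- move=> a a' aa'; rewrite (partial_joint_determined aa').
  by rewrite (pi_det _ _ h _ _ aa').
- move=> a a' aa'; rewrite (partial_joint_determined aa') (aa' i)//.
  by rewrite (pi_det _ _ (fun u => g u (a' i)) _ _ aa').
(* The cardinal allows resampling coordinate [i]. On the right this produces [h] by definition; on
   the left [h] ignores the new value and the weights sum to 1. *)
apply: (mulfI (card_coordinate_neq0 i)).
under eq_bigr => a _ do rewrite partial_jointS -mulrA.
under [in RHS]eq_bigr => a _ do rewrite partial_jointS -mulrA.
have Li := @partial_joint_determined i.
rewrite (coordinate_sum (fun u b => q u b * h u) Li).
rewrite (coordinate_sum (fun u b => q u b * g u b) Li).
by apply: eq_bigr => a _; rewrite -mulr_suml (q_pmf _).2 mul1r.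
Qed.

Lemma ln_prod (I : Type) (r : seq I) (F : I -> R) : (forall i, 0 < F i) ->
  ln (\prod_(i <- r) F i) = \sum_(i <- r) ln (F i).
Proof.
move=> F0; elim: r => [|i r IH]; first by rewrite !big_nil ln1.
by rewrite !big_cons lnM ?posrE// ?prodr_gt0// IH.
Qed.

Lemma joint_ln (a : outcome A) :
  joint q a * ln (joint q a)
  = \sum_(i < d) joint q a * ln (q (pre a i) (a i)).
Proof.
(* With [ln 0 = 0] the product rule for [ln] may fail at a null outcome, but there the weight kills
   both sides. Otherwise no factor vanishes, so all are positive. *)
have [->|j0] := eqVneq (joint q a) 0.
  by rewrite mul0r big1// => i _; rewrite mul0r.
rewrite -mulr_sumr ln_prod// => i; rewrite lt_neqAle (q_pmf _).1 andbT eq_sym.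
by move: j0 => /prodf_neq0; apply.
Qed.

Lemma sum_joint_smoothed_entropy :
  \sum_(a : outcome A) joint q a * smoothed_entropy q a = entropy (joint q).
Proof.
under eq_bigr => a _ do rewrite mulr_sumr.
rewrite /entropy; under [in RHS]eq_bigr => a _ do rewrite joint_ln.
rewrite exchange_big [in RHS]exchange_big -sumrN; apply: eq_bigr => i _ /=.
(* For this [g] the inner sum over [b] is minus the entropy of the conditional law. *)
rewrite -(conditional_expectation (fun u b => ln (q u b))) -sumrN.
by apply: eq_bigr => a _; rewrite mulrN.
Qed.

(** Since [X] has finitely many values, [f (X w)] is a finite combination of indicators of its
    fibres, integrated term by term. *)
Lemma expectation_outcome (disp : measure_display) (T : measurableType disp)
    (P : probability T R) (X : {RV P >-> outcome A}) (f : outcome A -> R) :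
  ('E_P[fun w => f (X w)]
   = \sum_(a : outcome A) (f a)%:E * distribution P X [set a])%E.
Proof.
have mX a : measurable (X @^-1` [set a]).
  by rewrite -[X in measurable X]setTI; exact: measurable_funP.
rewrite unlock.
transitivity (\int[P]_w \sum_(a : outcome A)
    (f a)%:E * (\1_(X @^-1` [set a]) w)%:E)%E.
  apply: eq_integral => w _; rewrite (bigD1 (X w))//= indicE mem_set//= mule1.
  rewrite big1 ?adde0// => a aX; rewrite indicE memNset ?mule0//=.
  by move=> Xa; rewrite Xa eqxx in aX.
rewrite integral_sum//; last first.
  by move=> a; apply: integrableZl => //; exact: integrable_indic.
apply: eq_bigr => a _; rewrite integralZl//; last exact: integrable_indic.
by rewrite integral_indic// setIT.
Qed.

End outcome_sums.

Theorem theorem1 (R : realType) (d : nat) (A : 'I_d -> pointedFinType)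
    (Theta : Type) (p : Theta -> conditionals R A)
    (hp : forall (theta : Theta) (i : 'I_d)
            (u : outcome_prefix A (ltnW (ltn_ord i))), is_pmf (p theta i u))
    (theta : Theta)
    (disp : measure_display) (T : measurableType disp) (P : probability T R)
    (X : {RV P >-> outcome A})
    (hX : forall a : outcome A,
            distribution P X [set a] = (joint (p theta) a)%:E) :
  ('E_P[fun w : T => smoothed_entropy (p theta) (X w)]
   = (entropy (joint (p theta)))%:E)%E.
Proof.
rewrite expectation_outcome -(sum_joint_smoothed_entropy (hp theta)) -sumEFin.
by apply: eq_bigr => a _; rewrite hX -EFinM mulrC.
Qed.
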